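(* Let $R$ be the polynomial ring $\mathbb{C}[y_\alpha\mid \alpha\in A]$ and let $I\subset R$ be the ideal of the rough Veronese variety $\mathcal{R}_{d,k,m}$. Let $I(2)\subset I$ be the vector subspace of degree two forms, and let $V\subset\mathrm{Proj}\,R$ be the projective variety defined by (the vanishing of all elements of) $I(2)$. Then $\mathcal{R}_{d,k,m}$ is an irreducible component of $V$.
   Context: Let $d\ge2$ and $k,m\ge1$ be integers. Let $T((\mathbb{R}^d))=\prod_{k\ge 0}(\mathbb{R}^d)^{\otimes k}$ be the algebra of formal power series in non-commuting variables $x_1,\dots,x_d$ (product: tensor/concatenation product), and let $p_k:T((\mathbb{R}^d))\to(\mathbb{R}^d)^{\otimes k}$ be the projection. Let $\mathrm{Lie}(\mathbb{R}^d)$ be the smallest vector subspace containing $x_1,\dots,x_d$ and closed under $[T,S]=TS-ST$, and let $\mathrm{Lie}^m(\mathbb{R}^d)$ be its truncation to tensor orders at most $m$ (regarded inside $T((\mathbb{R}^d))$). Put $\exp(L)=\sum_{n\ge0}L^{\otimes n}/n!$. The rough Veronese variety $\mathcal{R}_{d,k,m}\subset\mathbb{P}^{d^k-1}$ (over $\mathbb{C}$) is the Zariski closure of the image of the composition $\mathrm{Lie}^m(\mathbb{R}^d)\xrightarrow{\exp}T((\mathbb{R}^d))\xrightarrow{p_k}(\mathbb{R}^d)^{\otimes k}\to(\mathbb{C}^d)^{\otimes k}\dashrightarrow\mathbb{P}^{d^k-1}$. A non-empty word $w$ in the alphabet $\{1,\dots,d\}$ is Lyndon if whenever $w=pq$ with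 $p,q$ nonempty words, $w<q$ in lexicographic order. Let $W_{d,m}$ be the set of Lyndon words of length at most $m$. Let $S=\mathbb{C}[x_w\mid w\in W_{d,m}]$ be graded by giving $x_w$ weight equal to the length of $w$, let $A$ be the set of monomials of $S$ of weighted degree $k$, and let $R=\mathbb{C}[y_\alpha\mid\alpha\in A]$ with the standard grading. It is known that, after a linear change of coordinates, $\mathcal{R}_{d,k,m}$ lies in the linear subspace $\mathrm{Proj}\,R=\mathbb{P}^{\#A-1}$ of $\mathbb{P}^{d^k-1}$, and its homogeneous prime ideal there is the kernel of the ring homomorphism $R\to S$, $y_\alpha\mapsto\alpha$. ''The ideal of $\mathcal{R}_{d,k,m}$'' means this kernel. *)

(* Defs.v *)
From HB Require Import structures.
From mathcomp Require Import all_boot all_order all_algebra.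
From mathcomp Require Import boolp classical_sets reals.
From mathcomp Require Import complex.
From mathcomp Require Import mpoly.

Set Implicit Arguments.
Unset Strict Implicit.
Unset Printing Implicit Defensive.

Import Order.TTheory GRing.Theory Num.Theory.
Local Open Scope ring_scope.
Local Open Scope classical_set_scope.

(* Subsets of the projective space P^(n-1) over F are represented by sets of
   nonzero row vectors of homogeneous coordinates.  Only homogeneous
   polynomials are tested, so all closed sets below are invariant under
   rescaling. *)
Section ProjectiveSets.
Variables (F : fieldType) (n : nat).
Implicit Types (J : set {mpoly F[n]}) (X Y Z V : set 'rV[F]_n).

Definition proj_zeros J : set 'rV[F]_n :=
  [set v : 'rV[F]_n | v != 0 /\
     forall (e : nat) f, J f -> f \is e.-homog -> f.@[v ord0] = 0].

Definition proj_closed X : Prop := exists J, X = proj_zeros J.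

Definition proj_closure X : set 'rV[F]_n :=
  proj_zeros [set f : {mpoly F[n]} | forall v : 'rV[F]_n, X v -> f.@[v ord0] = 0].

Definition proj_irreducible X : Prop :=
  X !=set0 /\
  forall Y Z, proj_closed Y -> proj_closed Z ->
    X `<=` Y `|` Z -> X `<=` Y \/ X `<=` Z.

Definition irreducible_component X V : Prop :=
  [/\ proj_irreducible X, X `<=` V
    & forall Y, proj_irreducible Y -> X `<=` Y -> Y `<=` V -> Y = X].

End ProjectiveSets.

(* An element of T((R^d)) is the function sending a word to the coefficient
   of the corresponding noncommutative monomial. *)
Section RoughVeronese.
Variables (R : realType) (d : nat).

Definition tensor_series := seq 'I_d -> R.
Implicit Types S T L : tensor_series.

Definition ts_letter (i : 'I_d) : tensor_series := fun w => (w == [:: i])%:R.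

Definition ts_one : tensor_series := fun w => (w == [::])%:R.

Definition ts_mul T S : tensor_series :=
  fun w => \sum_(i < (size w).+1) T (take i w) * S (drop i w).

Definition ts_pow L (n : nat) : tensor_series := iter n (ts_mul L) ts_one.

Inductive Lie : set tensor_series :=
| Lie_letter i : Lie (ts_letter i)
| Lie_add S T : Lie S -> Lie T -> Lie (fun w => S w + T w)
| Lie_scale (c : R) T : Lie T -> Lie (fun w => c * T w)
| Lie_bracket S T :
    Lie S -> Lie T -> Lie (fun w => ts_mul S T w - ts_mul T S w).

Definition ts_trunc (m : nat) T : tensor_series :=
  fun w => if (size w <= m)%N then T w else 0.

Definition Lie_trunc (m : nat) : set tensor_series := ts_trunc m @` Lie.

(* The terms n > size w of the exponential series vanish at w when L has no
   constant term, as is the case for Lie elements. *)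
Definition ts_exp L : tensor_series :=
  fun w => \sum_(n < (size w).+1) ts_pow L n w / n`!%:R.

(* The k-th tensor power of C^d has coordinates indexed by words of length k,
   enumerated by enum_val. *)
Definition tensor_coords (k : nat) T : 'rV[R[i]]_#|{: k.-tuple 'I_d}| :=
  \row_j (T (enum_val j : k.-tuple 'I_d))%:C%C.

Definition rough_veronese (k m : nat) : set 'rV[R[i]]_#|{: k.-tuple 'I_d}| :=
  proj_closure
    [set v | v != 0 /\ exists2 L, Lie_trunc m L & v = tensor_coords k (ts_exp L)].

End RoughVeronese.

Arguments rough_veronese R d k m : clear implicits.

(* In the lexicographic order of seqlexi a proper prefix of a word is smaller
   than the word. *)
Definition lyndon (d : nat) (w : seq 'I_d) : bool :=
  (w != [::]) &&
  [forall i : 'I_(size w),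
     (0 < i)%N ==> ((w : seqlexi 'I_d) < (drop i w : seqlexi 'I_d))%O].

Definition lyndon_word (d m : nat) : finType := {w : m.-bseq 'I_d | lyndon w}.

Definition word_weight (d m : nat) (a : 'X_{1..#|lyndon_word d m|}) : nat :=
  (\sum_j a j * size (val (enum_val j)))%N.

Lemma mdeg_word_weight (d m : nat) (a : 'X_{1..#|lyndon_word d m|}) :
  (mdeg a <= word_weight a)%N.
Proof.
rewrite mdegE; apply: leq_sum => j _; apply: leq_pmulr.
by case: (enum_val j) => w /= /andP[]; rewrite -size_eq0 lt0n.
Qed.

(* The set A of monomials of weight k.  By mdeg_word_weight, the degree bound
   k.+1, which makes the type finite, excludes none of them. *)
Definition weighted_monomial (d k m : nat) : finType :=
  {a : 'X_{1..#|lyndon_word d m| < k.+1} | word_weight a == k}.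

Section ToricIdeal.
Variables (F : fieldType) (d k m : nat).

(* The ring homomorphism R -> S, y_a |-> a. *)
Definition monomial_map (f : {mpoly F[#|weighted_monomial d k m|]}) :
    {mpoly F[#|lyndon_word d m|]} :=
  f \mPo [tuple 'X_[val (val (enum_val j))] | j < #|weighted_monomial d k m|].

Definition veronese_ideal : set {mpoly F[#|weighted_monomial d k m|]} :=
  [set f | monomial_map f = 0].

(* The degree-e part I(e) of the ideal I. *)
Definition veronese_ideal_deg (e : nat) :
    set {mpoly F[#|weighted_monomial d k m|]} :=
  [set f | veronese_ideal f /\ f \is e.-homog].

End ToricIdeal.

Arguments veronese_ideal F d k m : clear implicits.
Arguments veronese_ideal_deg F d k m e : clear implicits.

(* The full-rank matrix M embeds Proj R linearly into the projective space of
   the k-th tensor power, by u |-> u *m M.  It is a choice of coordinates of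
   the required kind when the image contains the rough Veronese variety and the
   homogeneous ideal of the variety, read in Proj R, is the kernel of y_a |-> a. *)
Definition veronese_coordinates (R : realType) (d k m : nat)
    (M : 'M[R[i]]_(#|weighted_monomial d k m|, #|{: k.-tuple 'I_d}|)) : Prop :=
  [/\ row_free M,
      forall v, rough_veronese R d k m v -> (v <= M)%MS
    & forall (e : nat) (f : {mpoly R[i][#|weighted_monomial d k m|]}),
        f \is e.-homog ->
        veronese_ideal R[i] d k m f <->
        (forall u, rough_veronese R d k m (u *m M) -> f.@[u ord0] = 0)].

(* Main.v *)
Require Import Defs.
From mathcomp Require Import all_boot all_order all_algebra.
From mathcomp Require Import boolp classical_sets reals.
From mathcomp Require Import complex.
From mathcomp Require Import mpoly.
From mathcomp Require Import zify.

(** Write X for the zero set of the toric ideal I and V for that of I(2), and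
    let x be the variable of S attached to a single letter, which has weight 1.

    The variety X is irreducible because the target S of y_a |-> a is an
    integral domain: if a product of two forms vanishes on X, it vanishes at
    the monomial points (t^a)_a, so its image in S is zero at every t and is the
    zero polynomial ([mpoly_vanishing_eq0]); hence one of the two forms lies in I
    ([proj_irreducible_toric]).

    On the chart where the coordinate of x^k is nonzero, V and X agree
    ([toric_of_quadrics_on_chart]).  If a variable x_w other than x divides a
    monomial a of weight k, then a x^|w| / x_w and x_w x^(k - |w|) again have
    weight k, and
      a * x^k = (a x^|w| / x_w) * (x_w x^(k - |w|))
    is a quadratic relation.  So the coordinate v_a of a point of V is
    determined by the coordinate at a monomial with fewer factors other than x,
    and by induction v_a = c t^a with c = v_(x^k) and
    t_w = v_(x_w x^(k - |w|)) / c; such a point satisfies all of I.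

    An irreducible set between X and V is then covered by X and the hyperplane
    where the coordinate of x^k vanishes; it is not inside the hyperplane since
    X is not, so it is X ([irreducible_component_of_open]).

    In a tensor space, the hypothesis on M says that the rough Veronese variety
    is the image of X by the linear embedding M ([rough_veronese_image]), and
    the same criterion applies with the hyperplane transported along a
    one-sided inverse of M. *)

Set Implicit Arguments.
Unset Strict Implicit.
Unset Printing Implicit Defensive.

Import Order.TTheory GRing.Theory Num.Theory.
Local Open Scope ring_scope.
Local Open Scope classical_set_scope.

(** * Polynomials vanishing at every point *)

(** Every coefficient of p can be read off [muni p], so [muni] is injective. *)
Lemma coef_muni (n : nat) (A : nzRingType) (p : {mpoly A[n.+1]})
    (a : 'X_{1..n.+1}) :
  (muni p)`_(a ord_max)@_[multinom a (widen_ord (leqnSn n) i) | i < n] = p@_a.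
Proof.
rewrite muniE coef_sum raddf_sum /=.
transitivity (\sum_(b <- msupp p) p@_b * (b == a)%:R).
  apply: eq_bigr => b _.
  rewrite coefZ coefXn -mulr_natr mulr_natr mulrnAr mulr1 mcoeffMn mcoeffZ mcoeffX.
  rewrite -mulrnAr; congr (_ * _).
  have -> : (b == a) = ([multinom b (widen_ord (leqnSn n) i) | i < n] ==
      [multinom a (widen_ord (leqnSn n) i) | i < n]) && (a ord_max == b ord_max).
    apply/eqP/andP => [->|[/eqP eqw /eqP eqm]]; first by rewrite !eqxx.
    apply/mnmP => i; have [lt_in|] := ltnP i n.
      have := congr1 (fun c : 'X_{1..n} => c (Ordinal lt_in)) eqw.
      rewrite !mnmE; have -> // : widen_ord (leqnSn n) (Ordinal lt_in) = i.
      exact: val_inj.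
    move=> le_ni; have -> // : i = ord_max.
    by apply: val_inj; apply/eqP; rewrite eqn_leq le_ni -ltnS ltn_ord.
  by case: (a ord_max == _); case: eqP.
have [pa|pa] := boolP (a \in msupp p).
  rewrite (bigD1_seq a) //= ?msupp_uniq // eqxx mulr1 big1 ?addr0 // => b.
  by move/negPf->; rewrite mulr0.
rewrite big1_seq ?memN_msupp_eq0 // => b /andP[_ pb].
by case: eqP pb pa => [->->|]; rewrite ?mulr0.
Qed.

Lemma muni_meval (n : nat) (A : comNzRingType) (p : {mpoly A[n.+1]})
    (v : 'I_n.+1 -> A) :
  p.@[v] =
  (map_poly (meval (v \o widen_ord (leqnSn n))) (muni p)).[v ord_max].
Proof.
rewrite muniE raddf_sum /= horner_sum mevalE; apply: eq_bigr => b _.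
rewrite map_polyZ /= map_polyXn mevalZ mevalX hornerZ hornerXn -mulrA.
congr (_ * _); rewrite big_ord_recr /=; congr (_ * _).
by apply: eq_bigr => i _; rewrite mnmE.
Qed.

Lemma poly_vanishing_eq0 (A : numDomainType) (p : {poly A}) :
  (forall x, p.[x] = 0) -> p = 0.
Proof.
move=> p0; pose rs := [seq (i%:R : A) | i <- iota 0 (size p)].
apply: (@roots_geq_poly_eq0 _ _ rs).
- by apply/allP => x _; rewrite /root p0.
- by rewrite map_inj_uniq ?iota_uniq // => i j /eqP; rewrite eqr_nat => /eqP.
- by rewrite size_map size_iota.
Qed.

(** By induction on the number of variables: freezing all variables but the
    last leaves a univariate polynomial vanishing everywhere, so each of its
    coefficients, a polynomial in the other variables, vanishes everywhere. *)
Lemma mpoly_vanishing_eq0 (A : numDomainType) (n : nat) (p : {mpoly A[n]}) :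
  (forall v, p.@[v] = 0) -> p = 0.
Proof.
elim: n p => [|n IHn] p p0.
  by have := p0 (fun=> 0); rewrite (nvar0_mpolyC p) mevalC => ->; rewrite mpolyC0.
suff munip0 : muni p = 0.
  by apply/mpolyP => a; rewrite -coef_muni munip0 coef0 !mcoeff0.
apply/polyP => i; rewrite coef0; apply: IHn => v.
rewrite -(coef_map (meval v)) (_ : map_poly _ _ = 0) ?coef0 //.
apply: poly_vanishing_eq0 => x.
pose w (j : 'I_n.+1) := if insub (j : nat) is Some j' then v j' else x.
have wv : w \o widen_ord (leqnSn n) = v by apply/funext => j; rewrite /w /= valK.
have wx : w ord_max = x by rewrite /w insubF //= ltnn.
by have := p0 w; rewrite muni_meval wv wx.
Qed.

(** * Linear maps and irreducible components of projective sets *)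

Section ProjectiveLemmas.
Variable F : fieldType.

Lemma meval_scale (n e : nat) (f : {mpoly F[n]}) (c : F) (v : 'I_n -> F) :
  f \is e.-homog -> f.@[fun i => c * v i] = c ^+ e * f.@[v].
Proof.
move=> /dhomogP fe; rewrite !mevalE mulr_sumr; apply: eq_big_seq => a /fe <-.
rewrite mulrCA; congr (_ * _); rewrite /= mdegE -prodrXr -big_split /=.
by apply: eq_bigr => i _; rewrite exprMn.
Qed.

Definition linear_pullback (p q : nat) (M : 'M[F]_(p, q)) (f : {mpoly F[q]}) :
    {mpoly F[p]} :=
  f \mPo [tuple \sum_j M j i *: 'X_j | i < q].

Lemma meval_linear_pullback p q (M : 'M_(p, q)) f (u : 'rV_p) :
  (linear_pullback M f).@[u ord0] = f.@[(u *m M) ord0].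
Proof.
rewrite comp_mpoly_meval; apply: meval_eq => i; rewrite tnth_mktuple mxE.
rewrite raddf_sum /=; apply: eq_bigr => j _.
by rewrite mevalZ mevalXU mulrC.
Qed.

Lemma dhomog_linear_pullback p q (M : 'M_(p, q)) f e :
  f \is e.-homog -> linear_pullback M f \is e.-homog.
Proof.
move=> /dhomogP fe; rewrite /linear_pullback comp_mpolyEX big_seq.
apply: rpred_sum => a /fe <-; apply: rpredZ; rewrite comp_mpolyX /= mdegE.
elim/big_ind2: _ => [|g c h e' gc he|i _]; first exact: dhomog1.
  exact: dhomogM.
have := @dhomogMn _ _ mdeg 1; rewrite -{2}[a i]mul1n; apply; rewrite tnth_mktuple.
by apply: rpred_sum => j _; apply: rpredZ; rewrite dhomogX /= mdeg1.
Qed.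

Lemma row_free_mul_neq0 p q (M : 'M[F]_(p, q)) (u : 'rV_p) :
  row_free M -> (u *m M != 0) = (u != 0).
Proof.
by move=> freeM; congr negb; apply: mulmx_free_eq0.
Qed.

(** Freeness of the rows keeps nonzero vectors nonzero, so that u |-> u *m M is
    defined on the whole projective space. *)
Lemma proj_closed_preimage p q (M : 'M[F]_(p, q)) Y :
  row_free M -> proj_closed Y -> proj_closed [set u | Y (u *m M)].
Proof.
move=> freeM [J ->].
exists [set f | exists e g, [/\ J g, g \is e.-homog & f = linear_pullback M g]].
apply/seteqP; split => u [u0 zu]; split; rewrite ?row_free_mul_neq0 // in u0 *.
  move=> e _ [e' [g [Jg ge ->]]] _.
  by rewrite meval_linear_pullback; apply: zu Jg ge.
move=> e g Jg ge; rewrite -meval_linear_pullback.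
by apply: (zu e); [exists e, g | apply: dhomog_linear_pullback].
Qed.

Lemma proj_irreducible_image p q (M : 'M[F]_(p, q)) X :
  row_free M -> proj_irreducible X ->
  proj_irreducible [set u *m M | u in X].
Proof.
move=> freeM [[u Xu] irrX]; split; first by exists (u *m M), u.
move=> Y Z clY clZ XYZ.
have [||w Xw|XY|XZ] := irrX [set u | Y (u *m M)] [set u | Z (u *m M)].
- exact: proj_closed_preimage.
- exact: proj_closed_preimage.
- by apply: XYZ; exists w.
- by left => _ [w Xw <-]; apply: XY.
- by right => _ [w Xw <-]; apply: XZ.
Qed.

(** An irreducible Y between X and V is contained in the union of the closed
    sets X and {h = 0}, by the agreement of X and V where h is nonzero; the
    point of X off {h = 0} rules out the second alternative. *)
Lemma irreducible_component_of_open (n e : nat) (X V : set 'rV[F]_n) h :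
  proj_closed X -> proj_irreducible X -> X `<=` V ->
  (forall v, V v -> v != 0) -> h \is e.-homog ->
  (exists2 v, X v & h.@[v ord0] != 0) ->
  (forall v, V v -> h.@[v ord0] != 0 -> X v) ->
  irreducible_component X V.
Proof.
move=> clX irrX XV V0 he [x Xx hx] chart; split=> // Y [_ irrY] XY YV.
apply/seteqP; split=> //.
have [||y Yy|//|YH] := irrY X (proj_zeros [set h]).
- exact: clX.
- by exists [set h].
- have [hy|hy] := eqVneq (h.@[y ord0]) 0.
    by right; split=> [|e' _ -> _//]; apply/V0/YV.
  by left; apply: chart => //; apply: YV.
- by have [_ /(_ e h erefl he)] := YH _ (XY _ Xx); move/eqP: hx.
Qed.

End ProjectiveLemmas.

(** * Toric ideals *)

Section Toric.
Variables (F : fieldType) (n N : nat) (alpha : 'I_N -> 'X_{1..n}).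

Definition toric_map (f : {mpoly F[N]}) : {mpoly F[n]} :=
  f \mPo [tuple 'X_[alpha j] | j < N].

Definition toric_ideal : set {mpoly F[N]} := [set f | toric_map f = 0].

Definition monomial_point (t : 'I_n -> F) : 'rV[F]_N :=
  \row_j ('X_[alpha j]).@[t].

Lemma meval_toric_map f t :
  (toric_map f).@[t] = f.@[monomial_point t ord0].
Proof.
by rewrite comp_mpoly_meval; apply: meval_eq => j; rewrite tnth_mktuple mxE.
Qed.

Lemma monomial_point_zeros t :
  monomial_point t != 0 -> proj_zeros toric_ideal (monomial_point t).
Proof. by move=> t0; split=> // e f /= f0 _; rewrite -meval_toric_map f0 meval0. Qed.

Lemma monomial_point_neq0 t j :
  ('X_[alpha j]).@[t] != 0 -> monomial_point t != 0.
Proof. by apply: contraNneq => /rowP/(_ j); rewrite !mxE => ->. Qed.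

Lemma meval_monomial1 j : ('X_[alpha j]).@[fun=> 1] = 1 :> F.
Proof. by rewrite mevalX big1 // => i _; rewrite expr1n. Qed.

Lemma monomial_point1_zeros (j : 'I_N) :
  proj_zeros toric_ideal (monomial_point (fun=> 1)).
Proof.
apply/monomial_point_zeros/(@monomial_point_neq0 _ j).
by rewrite meval_monomial1 oner_neq0.
Qed.

Lemma toric_quadric_relation v a b c e :
  proj_zeros [set f | toric_ideal f /\ f \is 2.-homog] v ->
  (alpha a + alpha b = alpha c + alpha e)%MM ->
  v ord0 a * v ord0 b = v ord0 c * v ord0 e.
Proof.
move=> [_ Vv] abce; apply/eqP; rewrite -subr_eq0; apply/eqP.
have hom2 i j : ('X_i * 'X_j : {mpoly F[N]}) \is 2.-homog.
  by rewrite -mpolyXD dhomogX /= mdegD !mdeg1.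
have := Vv 2 ('X_a * 'X_b - 'X_c * 'X_e).
rewrite mevalB !mevalM !mevalXU; apply; last exact: rpredB (hom2 _ _) (hom2 _ _).
split; last exact: rpredB (hom2 _ _) (hom2 _ _).
rewrite /toric_ideal /= /toric_map rmorphB !rmorphM /= !comp_mpolyXU.
by rewrite -!tnth_nth !tnth_mktuple -!mpolyXD abce subrr.
Qed.

End Toric.

Arguments toric_ideal F {n N} alpha _.

(** Two forms f and g that both fail to vanish on X, but whose product vanishes
    on X, would have images in the domain of polynomials with product zero.  A
    parameter t may send all the monomials to 0 and so give no projective
    point; multiplying by one of the monomials disposes of those t. *)
Lemma proj_irreducible_toric (F : numFieldType) (n N : nat)
    (alpha : 'I_N -> 'X_{1..n}) (j : 'I_N) :
  proj_irreducible (proj_zeros (toric_ideal F alpha)).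
Proof.
split.
  by exists (monomial_point alpha (fun=> 1)); exact: monomial_point1_zeros.
move=> _ _ [J ->] [K ->] XJK.
have [|/existsNP[u /not_implyP[Xu nJu]]] :=
  pselect (proj_zeros (toric_ideal F alpha) `<=` proj_zeros J); first by left.
right=> v Xv; split=> [|e g Kg ge]; first by case: Xv.
have [d [f [Jf fd fu]]] :
    exists d f, [/\ J f, f \is d.-homog & f.@[u ord0] <> 0].
  apply: contrapT => nf; apply: nJu; split=> [|d f Jf fd]; first by case: Xu.
  by apply: contrapT => fu; apply: nf; exists d, f.
suff : 'X_[alpha j] * (toric_map alpha f * toric_map alpha g) == 0.
  rewrite !mulf_eq0 => /orP[/eqP/(congr1 (meval (fun=> 1)))|/orP[]/eqP I0].
  - by rewrite meval_monomial1 meval0 => /eqP; rewrite oner_eq0.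
  - by case: fu; apply: (proj2 Xu) fd.
  - exact: (proj2 Xv) ge.
apply/eqP/mpoly_vanishing_eq0 => t; rewrite !mevalM.
have [->|tj] := eqVneq ('X_[alpha j]).@[t] 0; first by rewrite mul0r.
have /XJK : proj_zeros (toric_ideal F alpha) (monomial_point alpha t).
  by apply/monomial_point_zeros/monomial_point_neq0/tj.
rewrite !meval_toric_map => -[[_ zt]|[_ zt]].
- by rewrite (zt d f) // mul0r mulr0.
- by rewrite (zt e g) // !mulr0.
Qed.

(** * Quadrics on the chart of a pure power *)

Section WeightedVeronese.
Variables (F : fieldType) (n N k : nat) (alpha : 'I_N -> 'X_{1..n}).
Variables (wt : 'I_n -> nat) (x : 'I_n).
Hypotheses (k_gt0 : (0 < k)%N) (wtx : wt x = 1%N).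
Hypothesis alpha_inj : injective alpha.
Let weight (a : 'X_{1..n}) := (\sum_i a i * wt i)%N.
Hypothesis alphaP : forall a, (exists j, alpha j = a) <-> weight a = k.

Let weightD a b : weight (a + b)%MM = (weight a + weight b)%N.
Proof.
by rewrite /weight -big_split; apply: eq_bigr => i _; rewrite mnmDE mulnDl.
Qed.

Let weightMn a r : weight (a *+ r)%MM = (weight a * r)%N.
Proof.
rewrite /weight big_distrl; apply: eq_bigr => i _ /=.
by rewrite mulmnE mulnAC.
Qed.

Let weight1 i : weight U_(i)%MM = wt i.
Proof.
rewrite /weight (bigD1 i) //= big1 => [|j ji]; rewrite mnm1E ?eqxx ?mul1n ?addn0 //.
by rewrite eq_sym (negPf ji).
Qed.

(** The quadrics force the coordinates of v to be c t^a, by induction on the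
    number of factors of a other than x: one such factor w is traded for
    x^(wt w) by the relation
      a * x^k = (a x^(wt w) / w) * (w x^(k - wt w)). *)
Lemma toric_of_quadrics_on_chart j0 v :
  alpha j0 = (U_(x) *+ k)%MM ->
  proj_zeros [set f | toric_ideal F alpha f /\ f \is 2.-homog] v ->
  v ord0 j0 != 0 -> proj_zeros (toric_ideal F alpha) v.
Proof.
move=> j0E Vv v0.
have [v_neq0 _] := Vv.
set c := v ord0 j0.
(* Coordinates are read off from monomials; 0 is the value off weight k. *)
pose val_at a := if [pick j | alpha j == a] is Some j then v ord0 j else 0.
have val_atE j : val_at (alpha j) = v ord0 j.
  rewrite /val_at; case: pickP => [i /eqP/alpha_inj -> //|/(_ j)].
  by rewrite eqxx.
have val_atM a b a' b' : weight a = k -> weight b = k -> weight a' = k ->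
    weight b' = k -> (a + b = a' + b')%MM ->
    val_at a * val_at b = val_at a' * val_at b'.
  move=> /alphaP[i <-] /alphaP[j <-] /alphaP[i' <-] /alphaP[j' <-].
  by rewrite !val_atE; apply: toric_quadric_relation.
have val_xk : val_at (U_(x) *+ k)%MM = c by rewrite -j0E val_atE.
(* If wt i > k the subtraction truncates and t i is 0; the variable i then
   divides no monomial of weight k. *)
pose t i := val_at (U_(i) + U_(x) *+ (k - wt i))%MM / c.
have tx : t x = 1.
  rewrite /t wtx (_ : _ + _ = U_(x) *+ k)%MM ?val_xk ?divff //.
  by apply/mnmP => i; rewrite mnmDE !mulmnE -{1}[U_(x)%MM i]muln1 -mulnDr subnKC.
have param a : weight a = k -> val_at a = c * ('X_[a]).@[t].
  have [r] := ubnP (\sum_(i | i != x) a i)%N.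
  elim: r a => // r IHr a; rewrite ltnS => le_ar wa.
  have [w /andP[wx aw]|ax] := pickP [pred i | (i != x) && (0 < a i)%N].
    have U_le : (U_(w) <= a)%MM by rewrite lep1mP -lt0n.
    (* a' is a with one factor w replaced by x^(wt w). *)
    pose a' := ((a - U_(w)) + U_(x) *+ wt w)%MM.
    have wwk : (wt w <= k)%N.
      by rewrite -wa -(submK U_le) weightD weight1 leq_addl.
    have wa' : weight a' = k.
      rewrite weightD weightMn weight1 wtx mul1n -weight1 -weightD.
      by rewrite submK.
    have ww : weight (U_(w) + U_(x) *+ (k - wt w))%MM = k.
      by rewrite weightD weightMn !weight1 wtx mul1n subnKC.
    have wxk : weight (U_(x) *+ k)%MM = k by rewrite weightMn weight1 wtx mul1n.
    have split_a : (a + U_(x) *+ k = a' + (U_(w) + U_(x) *+ (k - wt w)))%MM.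
      rewrite -{1}(submK U_le) /a'; apply/mnmP => i.
      rewrite !mnmDE !mulmnE -{1}(subnKC wwk) mulnDr; lia.
    have lt_a'r : (\sum_(i | i != x) a' i < r)%N.
      apply: leq_trans le_ar; rewrite (bigD1 w) //= [leqRHS](bigD1 w) //= -addSn.
      apply: leq_add => [|]; last apply: leq_sum => i /andP[ix iw].
        rewrite mnmDE mnmBE mulmnE !mnm1E eqxx eq_sym (negPf wx); lia.
      by rewrite mnmDE mnmBE mulmnE !mnm1E !(eq_sym _ i) (negPf ix) (negPf iw); lia.
    have Xa : ('X_[a]).@[t] = ('X_[a']).@[t] * t w :> F.
      rewrite -{1}(submK U_le) /a' !mpolyXD -mpolyXn !mevalM rmorphXn /=.
      by rewrite !mevalXU tx expr1n mulr1.
    apply: (mulIf v0); rewrite -/c -{1}val_xk.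
    rewrite (val_atM _ _ _ _ wa wxk wa' ww split_a).
    have -> : val_at (U_(w) + U_(x) *+ (k - wt w))%MM = t w * c by rewrite divfK.
    by rewrite (IHr _ lt_a'r wa') Xa !mulrA.
  have a_xk : a = (U_(x) *+ k)%MM.
    have a_x : a = (U_(x) *+ a x)%MM.
      apply/mnmP => i; rewrite mulmnE mnm1E.
      have [<-|xi] := eqVneq x i; first by rewrite mul1n.
      by have /= := ax i; rewrite eq_sym xi lt0n => /negbFE/eqP.
    by rewrite {1}a_x -wa {2}a_x weightMn weight1 wtx mul1n.
  by rewrite a_xk val_xk -mpolyXn rmorphXn /= mevalXU tx expr1n mulr1.
split=> // e f If fe.
have -> : f.@[v ord0] = f.@[fun j => c * monomial_point alpha t ord0 j].
  apply: meval_eq => j; rewrite -val_atE param; last by apply/alphaP; exists j.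
  by rewrite mxE.
by rewrite (meval_scale _ _ fe) -meval_toric_map If meval0 mulr0.
Qed.

End WeightedVeronese.

(** * The rough Veronese variety *)

Section RoughVeronese.
Variables d k m : nat.

Definition weighted_exponent (j : 'I_#|weighted_monomial d k m|) :
  'X_{1..#|lyndon_word d m|} := val (val (enum_val j)).

Lemma weighted_exponent_inj : injective weighted_exponent.
Proof. by move=> i j /val_inj/val_inj/enum_val_inj. Qed.

Lemma weighted_exponentP a :
  (exists j, weighted_exponent j = a) <-> word_weight a = k.
Proof.
split=> [[j <-]|wa]; first exact/eqP/(valP (enum_val j)).
have deg_a : (mdeg a < k.+1)%N by rewrite ltnS -wa mdeg_word_weight.
have wa' : word_weight (BMultinom deg_a) == k by apply/eqP.
pose b : weighted_monomial d k m := Sub (BMultinom deg_a) wa'.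
by exists (enum_rank b); rewrite /weighted_exponent enum_rankK.
Qed.

Lemma lyndon_letter (i : 'I_d) : (0 < m)%N ->
  exists w : lyndon_word d m, size (val w) = 1%N.
Proof.
move=> m0; have sz : (size [:: i] <= m)%N by [].
have lw : lyndon (Bseq sz) by apply/andP; split=> //; apply/forallP => -[[|j] jlt].
by exists (Sub (Bseq sz) lw).
Qed.

End RoughVeronese.

(** Every form g vanishing on the image of the exponential pulls back to a form
    on Proj R vanishing on the points lying over the variety, that is to an
    element of the ideal I; this gives the inclusion from right to left. *)
Lemma rough_veronese_image (R : realType) (d k m : nat)
    (M : 'M[R[i]]_(#|weighted_monomial d k m|, #|{: k.-tuple 'I_d}|)) :
  veronese_coordinates M ->
  rough_veronese R d k m =
    [set u *m M | u in proj_zeros (veronese_ideal R[i] d k m)].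
Proof.
move=> [freeM RVM RVI].
apply/seteqP; split=> [v RVv|_ [u [u0 Xu] <-]].
  have /submxP[u vE] := RVM v RVv.
  exists u => //; split.
    by rewrite -(row_free_mul_neq0 u freeM) -vE; case: RVv.
  by move=> e f If fe; apply: (proj1 (RVI e f fe) If); rewrite -vE.
split=> [|e g Eg ge]; first by rewrite row_free_mul_neq0.
rewrite -meval_linear_pullback; apply: Xu (dhomog_linear_pullback M ge).
apply/(RVI e _ (dhomog_linear_pullback M ge)) => u' [_ zu'].
by rewrite meval_linear_pullback; apply: zu' ge.
Qed.

(* First conjunct: the variety in Proj R defined by the ideal I is a component
   of the variety V of I(2).  Second conjunct: the same for the Zariski closure
   of the image of the exponential in the space of tensors, whenever Proj R is
   embedded there by coordinates in which its ideal is I. *)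
Theorem proposition2p11 (R : realType) (d k m : nat)
    (hd : (2 <= d)%N) (hk : (1 <= k)%N) (hm : (1 <= m)%N) :
  irreducible_component
    (proj_zeros (veronese_ideal R[i] d k m))
    (proj_zeros (veronese_ideal_deg R[i] d k m 2)) /\
  (forall M : 'M[R[i]]_(#|weighted_monomial d k m|, #|{: k.-tuple 'I_d}|),
     veronese_coordinates M ->
     irreducible_component
       (rough_veronese R d k m)
       [set u *m M | u in proj_zeros (veronese_ideal_deg R[i] d k m 2)]).
Proof.
pose alpha := @weighted_exponent d k m.
have [w w1] := @lyndon_letter d m (Ordinal (ltnW hd)) hm.
pose x := enum_rank w.
have wtx : size (val (enum_val x)) = 1%N by rewrite enum_rankK.
have [j0 j0E] : exists j, alpha j = (U_(x) *+ k)%MM.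
  apply/weighted_exponentP; rewrite /word_weight (bigD1 x) //= big1.
    by rewrite mulmnE mnm1E eqxx wtx muln1 mul1n addn0.
  by move=> i ix; rewrite mulmnE mnm1E eq_sym (negPf ix).
set X := proj_zeros (veronese_ideal R[i] d k m).
set V := proj_zeros (veronese_ideal_deg R[i] d k m 2).
have irrX : proj_irreducible X.
  exact: (@proj_irreducible_toric R[i] _ _ alpha j0).
have XV : X `<=` V by move=> v [v0 zv]; split=> // e f [If _]; apply: zv.
have chart v : V v -> v ord0 j0 != 0 -> X v.
  exact: (toric_of_quadrics_on_chart hk wtx (@weighted_exponent_inj d k m)
    (@weighted_exponentP d k m) j0E).
have [p Xp pj0] : exists2 p, X p & p ord0 j0 != 0.
  exists (monomial_point alpha (fun=> 1)).
    exact: (@monomial_point1_zeros R[i] _ _ alpha j0).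
  by rewrite mxE meval_monomial1 oner_neq0.
have hX1 : ('X_j0 : {mpoly R[i][_]}) \is 1.-homog by rewrite dhomogX /= mdeg1.
split.
  apply: (irreducible_component_of_open (h := 'X_j0) _ irrX XV _ hX1).
  - by exists (veronese_ideal R[i] d k m).
  - by move=> v [].
  - by exists p => //; rewrite mevalXU.
  - by move=> v Vv; rewrite mevalXU; apply: chart.
move=> M coordM; have [freeM _ _] := coordM.
have RVE : rough_veronese R d k m = [set u *m M | u in X].
  exact: rough_veronese_image.
have MK (u : 'rV_#|weighted_monomial d k m|) : u *m M *m pinvmx M = u.
  by rewrite -mulmxA mulmxVp // mulmx1.
(* As pinvmx M is a right inverse of M, this linear form on tensors restricts to
   the coordinate of x^k on Proj R. *)
have hM (u : 'rV_#|weighted_monomial d k m|) :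
  (linear_pullback (pinvmx M) 'X_j0).@[(u *m M) ord0] = u ord0 j0.
  by rewrite meval_linear_pullback MK mevalXU.
apply: (@irreducible_component_of_open _ _ 1 _ _ (linear_pullback (pinvmx M) 'X_j0)).
- by eexists.
- by rewrite RVE; apply: proj_irreducible_image.
- by rewrite RVE => _ [u /XV Vu <-]; exists u.
- by move=> _ [u [u0 _] <-]; rewrite row_free_mul_neq0.
- exact: dhomog_linear_pullback.
- by exists (p *m M); rewrite ?hM // RVE; exists p.
- by move=> _ [u Vu <-]; rewrite hM RVE => uj0; exists u => //; apply: chart.
Qed.
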